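(* There exist absolute constants $c, C > 0$ such that the following holds. Let $\mathcal D$ be a distribution over $\mathcal X \times \{0,1\}$, let $\gamma \in (0,1]$, and let $\mathcal H$ be a class of splitting functions $\mathcal X \to \{0,1\}$ that satisfies the $\gamma$-weak learning assumption with respect to $\mathcal D$. Let $\varepsilon \in (0,1)$, let $\eta \le c\,\varepsilon\gamma$, and let $\widehat{\mathcal D}$ be any distribution over $\mathcal X\times\{0,1\}$ with $d_{\mathrm{TV}}(\mathcal D, \widehat{\mathcal D}) \le \eta$. Then for every $t \ge \exp\!\big(C/(\gamma^2\varepsilon^2)\big)$, the decision tree $T$ output by $\textsc{TopDownDT}_{\mathcal H, \mathcal G, \widehat{\mathcal D}}(t)$, with $\mathcal G(p) = 4p(1-p)$ (Gini impurity), satisfies $\Pr_{(\mathbf x,\mathbf y)\sim\mathcal D}[T(\mathbf x) \ne \mathbf y] \le \varepsilon$.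
   Context: For a distribution $\mathcal E$ over $\mathcal X\times\{0,1\}$ write $\mu(\mathcal E) = \Pr_{\mathcal E}[\mathbf y = 1]$. The Gini impurity is $\mathcal G(p)=4p(1-p)$. For a splitting function $h:\mathcal X\to\{0,1\}$, let $\mathcal E|_{h=b}$ denote $\mathcal E$ conditioned on $h(\mathbf x)=b$, and define the local impurity drop $\Delta_{\mathcal E}(h) = \mathcal G(\mu(\mathcal E)) - \Pr_{\mathcal E}[h(\mathbf x)=0]\,\mathcal G(\mu(\mathcal E|_{h=0})) - \Pr_{\mathcal E}[h(\mathbf x)=1]\,\mathcal G(\mu(\mathcal E|_{h=1}))$ (terms with zero probability are taken to be $0$). Decision trees: a decision tree over $\mathcal H$ is a rooted binary tree whose internal nodes $v$ are labeled by functions $h_v\in\mathcal H$; an input $x$ starts at the root and at each internal node $v$ goes to the child indexed by $h_v(x)\in\{0,1\}$ until it reaches a leaf; each leaf carries a label in $\{0,1\}$ which is the output $T(x)$. The size of $T$ is its number of leaves. For a distribution $\mathcal E$ and leaf $\ell$, $w_{\mathcal E}(\ell)=\Pr_{\mathcal E}[\mathbf x \text{ reaches } \ell]$ and $\mathcal E_\ell$ is $\mathcal E$ conditioned on $\mathbf x$ reaching $\ell$. For a leaf $\ell$ and $h\in\mathcal H$, $T_{\ell,h}$ is the tree obtained by replacing $\ell$ by an internal node labeled $h$ with two new leaf children. Algorithm $\textsc{TopDownDT}_{\mathcal H,\mathcal G,\mathcal E}(t)$: start with $T$ a single leaf; while size$(T)<t$, choose $(\ell^\star,h^\star)$ maximizing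 $w_{\mathcal E}(\ell)\cdot\Delta_{\mathcal E_\ell}(h)$ over leaves $\ell$ of $T$ and $h\in\mathcal H$ (ties broken arbitrarily; the maximum is assumed to be attained), and set $T\leftarrow T_{\ell^\star,h^\star}$; finally label each leaf $\ell$ by $\mathbf 1[\mu(\mathcal E_\ell)>1/2]$ and return $T$. Expectations are assumed to be computed exactly. Induced distributions: a distribution $\mathcal D'$ is induced by conditioning $\mathcal D$ on $\mathcal H$ if $\mathcal D'$ equals $\mathcal D$ conditioned on the event $h_1(\mathbf x)=b_1,\dots,h_k(\mathbf x)=b_k$ (of positive probability) for some $k\ge 0$, $h_i\in\mathcal H$, $b_i\in\{0,1\}$ (in particular, every leaf distribution $\mathcal D_\ell$ of a tree over $\mathcal H$ is induced). $\gamma$-weak learning assumption: $\mathcal H$ satisfies it w.r.t. $\mathcal D$ if for every distribution $\mathcal D'$ induced by conditioning $\mathcal D$ on $\mathcal H$ there is $h\in\mathcal H$ with $|\mathrm{Cov}_{\mathcal D'}[h(\mathbf x),\mathbf y]| \ge \gamma\,\mathrm{Var}_{\mathcal D'}[\mathbf y]$. $d_{\mathrm{TV}}$ denotes total variation distance. *)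

(* Defs.v *)
From HB Require Import structures.
From mathcomp Require Import all_boot all_order all_algebra.
From mathcomp Require Import all_classical all_reals all_analysis.
From mathcomp Require Import Rstruct.
From Stdlib Require Import Rdefinitions.

Set Implicit Arguments.
Unset Strict Implicit.
Unset Printing Implicit Defensive.

Import Order.TTheory GRing.Theory Num.Theory.
Local Open Scope classical_set_scope.
Local Open Scope ring_scope.

Notation RR := Rdefinitions.R.

Section Defs.
Context {d : measure_display} {X : measurableType d}.

Definition dist := probability (X * bool)%type RR.

Definition Pr (D : dist) (A : set (X * bool)) : RR := fine (D A).

(** Pr under D conditioned on the event B (0 if Pr_D[B] = 0). *)
Definition cPr (D : dist) (B A : set (X * bool)) : RR := Pr D (A `&` B) / Pr D B.

Definition yev : set (X * bool) := [set p : X * bool | p.2 = true].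
Definition hev (h : X -> bool) (b : bool) : set (X * bool) := [set p | h p.1 = b].

Definition mu (D : dist) (B : set (X * bool)) : RR := cPr D B yev.

Definition gini (p : RR) : RR := 4 * p * (1 - p).

Definition Delta (G : RR -> RR) (D : dist) (B : set (X * bool)) (h : X -> bool) : RR :=
  G (mu D B)
  - cPr D B (hev h false) * G (mu D (B `&` hev h false))
  - cPr D B (hev h true) * G (mu D (B `&` hev h true)).

Definition cov_hy (D : dist) (B : set (X * bool)) (h : X -> bool) : RR :=
  cPr D B (hev h true `&` yev) - cPr D B (hev h true) * mu D B.
Definition var_y (D : dist) (B : set (X * bool)) : RR := mu D B * (1 - mu D B).

Definition weak_learning (H : set (X -> bool)) (D : dist) (gamma : RR) : Prop :=
  forall (k : nat) (hs : 'I_k -> (X -> bool)) (bs : 'I_k -> bool),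
    (forall i, H (hs i)) ->
    let B := [set p : X * bool | forall i, hs i p.1 = bs i] in
    0 < Pr D B ->
    exists2 h, H h & gamma * var_y D B <= `| cov_hy D B h |.

Definition dTV_le (D D' : dist) (eta : RR) : Prop :=
  forall A : set (X * bool), measurable A -> `| Pr D A - Pr D' A | <= eta.

Inductive dtree := DLeaf of bool | DNode of (X -> bool) & dtree & dtree.

Fixpoint eval_tree (t : dtree) (x : X) : bool :=
  match t with
  | DLeaf b => b
  | DNode h t0 t1 => if h x then eval_tree t1 x else eval_tree t0 x
  end.

Fixpoint tsize (t : dtree) : nat :=
  match t with DLeaf _ => 1 | DNode _ t0 t1 => tsize t0 + tsize t1 end.

Fixpoint leaves (t : dtree) : seq (seq bool) :=
  match t with
  | DLeaf _ => [:: [::]]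
  | DNode _ t0 t1 => [seq false :: p | p <- leaves t0] ++ [seq true :: p | p <- leaves t1]
  end.

Fixpoint path_of (t : dtree) (x : X) : seq bool :=
  match t with
  | DLeaf _ => [::]
  | DNode h t0 t1 => h x :: path_of (if h x then t1 else t0) x
  end.

Definition reach (t : dtree) (p : seq bool) : set (X * bool) :=
  [set q : X * bool | path_of t q.1 = p].

Fixpoint grow (t : dtree) (p : seq bool) (h : X -> bool) : dtree :=
  match t, p with
  | DLeaf _, [::] => DNode h (DLeaf false) (DLeaf false)
  | DNode h' t0 t1, b :: p' =>
      if b then DNode h' t0 (grow t1 p' h) else DNode h' (grow t0 p' h) t1
  | _, _ => t
  end.

Fixpoint relabel_aux (t : dtree) (f : seq bool -> bool) : dtree :=
  match t with
  | DLeaf _ => DLeaf (f [::])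
  | DNode h t0 t1 =>
      DNode h (relabel_aux t0 (fun p => f (false :: p)))
              (relabel_aux t1 (fun p => f (true :: p)))
  end.

Definition score (G : RR -> RR) (E : dist) (t : dtree) (p : seq bool) (h : X -> bool) : RR :=
  Pr E (reach t p) * Delta G E (reach t p) h.

Definition greedy_step (H : set (X -> bool)) (G : RR -> RR) (E : dist) (t t' : dtree) : Prop :=
  exists p h, [/\ p \in leaves t, H h, t' = grow t p h &
    forall p' h', p' \in leaves t -> H h' -> score G E t p' h' <= score G E t p h].

Inductive tdd_loop (H : set (X -> bool)) (G : RR -> RR) (E : dist) (n : nat) : dtree -> Prop :=
  | tdd_start : tdd_loop H G E n (DLeaf false)
  | tdd_next (t t' : dtree) : tdd_loop H G E n t -> (tsize t < n)%nat ->
                    greedy_step H G E t t' -> tdd_loop H G E n t'.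

(** T is a possible output of TopDownDT_{H,G,E}(n) (ties broken arbitrarily).
    Each leaf l is labelled 1[mu(E_l) > 1/2]; leaves of E-weight 0 (where E_l is
    undefined) may carry any label. *)
Definition TopDownDT (H : set (X -> bool)) (G : RR -> RR) (E : dist) (n : nat) (T : dtree) : Prop :=
  exists t f, [/\ tdd_loop H G E n t, ~ (tsize t < n)%nat, T = relabel_aux t f &
    forall p, p \in leaves t -> 0 < Pr E (reach t p) ->
      f p = (1 / 2 < mu E (reach t p))].

Definition error (D : dist) (T : dtree) : RR := Pr D [set q : X * bool | eval_tree T q.1 != q.2].

End Defs.
Arguments dtree {d} X.

(* Main.v *)
Require Import Defs.
From HB Require Import structures.
From mathcomp Require Import all_boot all_order all_algebra.
From mathcomp Require Import all_classical all_reals all_analysis.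
From mathcomp Require Import Rstruct.
From mathcomp Require Import lra ring.
Import Order.TTheory GRing.Theory Num.Theory.
Local Open Scope classical_set_scope.
Local Open Scope ring_scope.

Set Implicit Arguments.
Unset Strict Implicit.
Unset Printing Implicit Defensive.

(** Let [Phi] be the leaf-weighted Gini impurity of the current tree under the
    observed distribution [Dh]; a greedy step lowers it by the chosen score.
    Splitting a leaf of weight [w] by [h] scores at least [16 w cov ^ 2], while
    the weights sum to 1, so by Cauchy-Schwarz some leaf scores at least
    [16 S ^ 2 / j], where [j] is the number of leaves and [S] the sum over the
    leaves of [w |cov|] for hypotheses picked by weak learning under [D].
    The leaf quantities [w cov] and [w var] are Lipschitz functions of the masses
    of events in the leaf, and these masses differ between [D] and [Dh] by
    [O(eta)] in total over the disjoint leaves; hence [S >= gamma Phi / 4 - O(eta)].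
    As long as [Phi > eps / 2], the step at size [j] thus gains
    [gamma ^ 2 eps ^ 2 / (16 j)]; the harmonic sum makes this impossible beyond
    size [exp (16 / (gamma eps) ^ 2)].  Finally the training error is at most
    [Phi / 2]. *)

(** * Real inequalities: stability of [a * b / w], and the Gini drop of one split *)

Lemma ratio_itv01 (R : realFieldType) (a w : R) :
  0 <= a <= w -> 0 <= a / w <= 1.
Proof.
case/andP=> a0 aw; have w0 := le_trans a0 aw.
rewrite divr_ge0 //=; move: w0; rewrite le_eqVlt => /predU1P[<-|w0].
  by rewrite invr0 mulr0.
by rewrite ler_pdivrMr // mul1r.
Qed.

(** On [0 <= a, b <= w] the partial derivatives of [a * b / w] are [b / w], [a / w] and
    [- (a / w) * (b / w)], all of modulus at most 1, so each of the three differences costs at most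
    [e]. Division by 0 gives 0, and the bound survives [w = 0] and [w' = 0]: the remaining quotient
    is at most its own denominator, hence at most [e]. *)
Lemma mul_div_lipschitz (R : realFieldType) (w a b w' a' b' e : R) :
  0 <= a <= w -> 0 <= b <= w -> 0 <= a' <= w' -> 0 <= b' <= w' ->
  `|w - w'| <= e -> `|a - a'| <= e -> `|b - b'| <= e ->
  `|a * b / w - a' * b' / w'| <= 3 * e.
Proof.
move=> aw bw aw' bw' we ae be.
have e0 : 0 <= e := le_trans (normr_ge0 _) we.
have [w0|w0] := eqVneq w 0.
  rewrite w0 invr0 mulr0 sub0r normrN -mulrA.
  case/andP: (ratio_itv01 bw'); move: (b' / w') => r r0 r1.
  move: aw' we; rewrite w0 sub0r normrN => /andP[a'0 aw'] we.
  rewrite ger0_norm ?mulr_ge0 //.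
  have : a' * r <= a' * 1 by rewrite ler_wpM2l.
  by rewrite mulr1; move: we; rewrite ger0_norm; lra.
have [w'0|w'0] := eqVneq w' 0.
  rewrite w'0 invr0 mulr0 subr0 -mulrA.
  case/andP: (ratio_itv01 bw); move: (b / w) => r r0 r1.
  move: aw we; rewrite w'0 subr0 => /andP[a0 aw] we.
  rewrite ger0_norm ?mulr_ge0 //.
  have : a * r <= a * 1 by rewrite ler_wpM2l.
  by rewrite mulr1; move: we; rewrite ger0_norm; lra.
have -> : a * b / w - a' * b' / w' =
    (a - a') * (b / w) + (a' / w') * ((b - b') - (b / w) * (w - w')).
  by field; rewrite w0.
have /andP[r0 r1] := ratio_itv01 bw.
have /andP[q0 q1] := ratio_itv01 aw'.
apply: le_trans (ler_normD _ _) _; rewrite (normrM (_ - _)) (normrM (_ / _)) (ger0_norm r0) (ger0_norm q0).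
have h1 : `|a - a'| * (b / w) <= e by rewrite -[e]mulr1 ler_pM.
have h2 : `|b - b' - b / w * (w - w')| <= e + e.
  apply: le_trans (ler_normB _ _) _; rewrite lerD //.
  by rewrite (normrM (_ / _)) (ger0_norm r0) -[e]mul1r ler_pM.
have h3 : a' / w' * `|b - b' - b / w * (w - w')| <= e + e.
  by rewrite -[e + e]mul1r ler_pM.
lra.
Qed.

(* With [W_i, Y_i] the masses of [h = i] and [h = i, y = 1], the drop of
   [W * gini (Y / W)] is [4 k ^ 2 W / (W0 W1) >= 16 k ^ 2 / W], where
   [k = Y1 - W1 Y / W]; the bound below is its tangent at slope [s]. *)
Lemma gini_drop_ge (R : realFieldType) (W W0 W1 Y Y0 Y1 s : R) :
  W = W0 + W1 -> Y = Y0 + Y1 ->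
  0 <= Y0 <= W0 -> 0 <= Y1 <= W1 ->
  16 * (2 * s * `|Y1 - W1 * Y / W| - s ^+ 2 * W) <=
  4 * (Y - Y * Y / W) - 4 * (Y0 - Y0 * Y0 / W0) - 4 * (Y1 - Y1 * Y1 / W1).
Proof.
move=> -> -> /andP[Y0p YW0] /andP[Y1p YW1].
have W0p := le_trans Y0p YW0; have W1p := le_trans Y1p YW1.
have sW v : 0 <= v -> 0 <= s ^+ 2 * v by move=> ?; rewrite mulr_ge0 ?sqr_ge0.
(* If one side of the split is null, both the drop and the covariance term vanish, and the left-hand
   side is [- 16 * s ^+ 2 * W]. *)
have [W00|W00] := eqVneq W0 0.
  have -> : Y0 = 0 by lra.
  rewrite W00 !(add0r, invr0, mulr0, subr0).
  have -> : Y1 - W1 * Y1 / W1 = 0.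
    have [W10|W10] := eqVneq W1 0; last by field.
    by rewrite W10 invr0 mulr0; lra.
  by rewrite normr0; have := sW _ W1p; lra.
have [W10|W10] := eqVneq W1 0.
  have -> : Y1 = 0 by lra.
  rewrite W10 !(addr0, invr0, mulr0, mul0r, subr0) normr0.
  by have := sW _ W0p; lra.
have {W00}W0p : 0 < W0 by rewrite lt_def W00.
have {W10}W1p : 0 < W1 by rewrite lt_def W10.
set k := Y1 - _.
have -> : 4 * (Y0 + Y1 - (Y0 + Y1) * (Y0 + Y1) / (W0 + W1)) -
    4 * (Y0 - Y0 * Y0 / W0) - 4 * (Y1 - Y1 * Y1 / W1) =
    4 * (k ^+ 2 * (W0 + W1)) / (W0 * W1).
  by rewrite /k; field; rewrite !gt_eqF ?addr_gt0.
rewrite -(real_normK (num_real k)); move: (`|k|) => {Y0p YW0 Y1p YW1}{}k.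
rewrite ler_pdivlMr ?mulr_gt0 //.
have W4 : 0 <= (W0 - W1) ^+ 2 := sqr_ge0 _.
have tangent : (2 * s * k - s ^+ 2 * (W0 + W1)) * (W0 + W1) <= k ^+ 2.
  by have := sqr_ge0 (k - s * (W0 + W1)); nra.
(* The inequality [4 * W0 * W1 <= (W0 + W1) ^+ 2] is about to be multiplied by this quantity, so its
   sign matters; when it is nonpositive the claim is trivial. *)
have [neg|/ltW pos] := leP (2 * s * k - s ^+ 2 * (W0 + W1)) 0.
  apply: (@le_trans _ _ 0).
    by rewrite mulr_le0_ge0 ?mulr_ge0_le0 // mulr_ge0 ?ltW.
  have W01 : 0 <= W0 + W1 by rewrite addr_ge0 ?ltW.
  by have := mulr_ge0 (sqr_ge0 k) W01; lra.
set m := 2 * s * k - _ in pos tangent *.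
have h1 : m * (4 * (W0 * W1)) <= m * (W0 + W1) ^+ 2.
  by apply: ler_wpM2l => //; move: W4; rewrite !expr2; lra.
have h2 : m * (W0 + W1) * (W0 + W1) <= k ^+ 2 * (W0 + W1).
  by apply: ler_wpM2r tangent; rewrite addr_ge0 ?ltW.
by move: h1 h2; rewrite expr2; lra.
Qed.

(* [Defs] elaborates real-valued definitions with Stdlib's operations on [R]. *)
Lemma giniE (p : RR) : gini p = 4 * p * (1 - p).
Proof. by rewrite /gini !RealsE. Qed.

(** * Masses of events, and total variation over disjoint families *)

Section Events.
Context {d : measure_display} {X : measurableType d}.
Implicit Types (D E : @dist d X) (A B : set (X * bool)) (h : X -> bool).

Lemma Pr_ge0 D A : 0 <= Pr D A.
Proof. by rewrite fine_ge0. Qed.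

Lemma Pr_setT D : Pr D setT = 1.
Proof. by rewrite /Pr probability_setT. Qed.

Lemma Pr_set0 D : Pr D set0 = 0.
Proof. by rewrite /Pr measure0. Qed.

Lemma PrU D A B : measurable A -> measurable B -> A `&` B = set0 ->
  Pr D (A `|` B) = Pr D A + Pr D B.
Proof. by move=> mA mB AB; rewrite /Pr measureU // fineD ?fin_num_measure. Qed.

Lemma Pr_le D A B : measurable A -> measurable B -> A `<=` B ->
  Pr D A <= Pr D B.
Proof.
by move=> mA mB AB; rewrite fine_le ?fin_num_measure // le_measure ?inE.
Qed.

Lemma measurable_yev : measurable (yev : set (X * bool)).
Proof.
have -> : yev = setT `&` snd @^-1` [set true] :> set (X * bool).
  by rewrite setTI.
exact: measurable_snd.
Qed.

Lemma measurable_hev h b : measurable_fun setT h -> measurable (hev h b).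
Proof.
move=> mh; have -> : hev h b = setT `&` (h \o fst) @^-1` [set b].
  by rewrite setTI.
exact: (measurableT_comp mh measurable_fst).
Qed.

Lemma Pr_split D B h : measurable_fun setT h -> measurable B ->
  Pr D B = Pr D (B `&` hev h false) + Pr D (B `&` hev h true).
Proof.
move=> mh mB; rewrite -PrU; [| exact: measurableI mB (measurable_hev _ mh) ..|].
  congr (Pr D _); apply/seteqP; split=> [q Bq|q [] []//].
  by case: (boolP (h q.1)) => hq; [right|left]; split=> //; apply/negbTE.
by apply/seteqP; split=> // q [[_ h0] [_ h1]]; move: h1; rewrite /hev /= h0.
Qed.

Lemma measurable_bigcup_seq (K : eqType) (F : K -> set (X * bool)) (s : seq K) :
  (forall k, measurable (F k)) ->
  measurable [set q | exists2 k, k \in s & F k q].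
Proof.
move=> mF; elim: s => [|k s IH].
  rewrite (_ : [set _ | _] = set0) //.
  by apply/seteqP; split=> // q [].
rewrite (_ : [set _ | _] = F k `|` [set q | exists2 k, k \in s & F k q]).
  exact: measurableU.
apply/seteqP; split=> q /=.
  by case=> k'; rewrite inE => /predU1P[->|ks] Fq; [left|right; exists k'].
by case=> [Fq|[k' ks Fq]]; [exists k|exists k'] => //; rewrite inE ?eqxx ?ks ?orbT.
Qed.

Lemma Pr_bigcup_seq D (K : eqType) (F : K -> set (X * bool)) (s : seq K) :
  (forall k, measurable (F k)) ->
  (forall k k' q, F k q -> F k' q -> k = k') -> uniq s ->
  Pr D [set q | exists2 k, k \in s & F k q] = \sum_(k <- s) Pr D (F k).
Proof.
move=> mF dF; elim: s => [_|k s IH /= /andP[ks us]].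
  rewrite big_nil -(Pr_set0 D); congr Pr.
  by apply/seteqP; split=> // q [].
rewrite big_cons -IH // -PrU //; last 2 first.
- exact: measurable_bigcup_seq.
- apply/seteqP; split=> // q [Fq [k' k's /(dF _ _ _ Fq) kk']].
  by rewrite kk' k's in ks.
congr Pr; apply/seteqP; split=> q /=.
  by case=> k'; rewrite inE => /predU1P[->|k's] Fq; [left|right; exists k'].
by case=> [Fq|[k' k's Fq]]; [exists k|exists k'] => //; rewrite inE ?eqxx ?k's ?orbT.
Qed.

(** Split the indices by the sign of the difference: in each half the absolute values add up to the
    discrepancy of one event, the union, which is at most [eta]. The bound does not depend on the
    number of events, hence not on the size of the tree. *)
Lemma dTV_le_sum D E (eta : RR) (K : eqType) (F : K -> set (X * bool)) (s : seq K) :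
  dTV_le D E eta ->
  (forall k, measurable (F k)) ->
  (forall k k' q, F k q -> F k' q -> k = k') -> uniq s ->
  \sum_(k <- s) `|Pr D (F k) - Pr E (F k)| <= 2 * eta.
Proof.
move=> tv mF dF us.
rewrite (bigID (fun k => Pr E (F k) <= Pr D (F k))) /= mulr2n mulrDl mul1r.
have part (P : pred K) : `|\sum_(k <- s | P k) (Pr D (F k) - Pr E (F k))| <= eta.
  rewrite big_split sumrN -!(big_filter s P) -!Pr_bigcup_seq ?filter_uniq //.
  apply: tv; exact: measurable_bigcup_seq.
apply: lerD.
- rewrite (eq_bigr (fun k => Pr D (F k) - Pr E (F k))); last first.
    by move=> k ?; rewrite ger0_norm ?subr_ge0.
  exact: le_trans (ler_norm _) (part _).
- rewrite (eq_bigr (fun k => - (Pr D (F k) - Pr E (F k)))); last first.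
    by move=> k; rewrite -ltNge => /ltW ?; rewrite ler0_norm ?subr_le0.
  by rewrite sumrN; apply: le_trans (ler_norm _) _; rewrite normrN; apply: part.
Qed.

(** Only the [F k] have to be disjoint. They will be the leaves, while [G k] depends on the
    hypothesis chosen at leaf [k]. *)
Lemma dTV_le_sumI D E (eta : RR) (K : eqType) (F G : K -> set (X * bool)) (s : seq K) :
  dTV_le D E eta ->
  (forall k, measurable (F k)) -> (forall k, measurable (G k)) ->
  (forall k k' q, F k q -> F k' q -> k = k') -> uniq s ->
  \sum_(k <- s) `|Pr D (G k `&` F k) - Pr E (G k `&` F k)| <= 2 * eta.
Proof.
move=> tv mF mG dF us.
apply: (dTV_le_sum (F := fun k => G k `&` F k) tv) us => [k|k k' q [_ Fq] [_]].
  exact: measurableI.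
exact: dF Fq.
Qed.

(** * Impurity and covariance of an event, weighted by its mass *)

Definition pot D B := Pr D B * gini (mu D B).

(** [Pr D B] times the covariance of [h] and [y] given [B] *)
Definition wcov D B h :=
  Pr D ((hev h true `&` yev) `&` B)
  - Pr D (hev h true `&` B) * Pr D (yev `&` B) / Pr D B.

Lemma cPrE D B A : cPr D B A = Pr D (A `&` B) / Pr D B.
Proof. exact: RdivE. Qed.

Lemma PrI_itv D A B : measurable A -> measurable B ->
  0 <= Pr D (A `&` B) <= Pr D B.
Proof.
move=> mA mB; rewrite Pr_ge0 /=.
by apply: Pr_le (measurableI _ _ mA mB) mB _; exact: subIsetr.
Qed.

(** If [B] is null, so is its intersection with [A]. Covering this case frees the weighted
    identities below from any positivity condition on leaves. *)
Lemma Pr_mul_cPr D A B : measurable A -> measurable B ->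
  Pr D B * cPr D B A = Pr D (A `&` B).
Proof.
move=> mA mB; rewrite cPrE mulrC; have [B0|B0] := eqVneq (Pr D B) 0.
  have := PrI_itv D mA mB; rewrite B0 mulr0 => /andP[h0 h1].
  by apply/le_anti; rewrite h0 h1.
by rewrite divfK.
Qed.

Lemma potE D B : measurable B ->
  pot D B = 4 * (Pr D (yev `&` B) - Pr D (yev `&` B) * Pr D (yev `&` B) / Pr D B).
Proof.
move=> mB; have yB := Pr_mul_cPr D measurable_yev mB.
rewrite /pot giniE /mu -yB; have [B0|B0] := eqVneq (Pr D B) 0.
  by rewrite B0 !mul0r subrr mulr0.
move: (Pr D B) (cPr D B yev) B0 => w p w0.
by field.
Qed.

Lemma wcovE D B h : measurable_fun setT h -> measurable B ->
  wcov D B h = Pr D B * cov_hy D B h.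
Proof.
move=> mh mB; have mhev := measurable_hev true mh.
rewrite /wcov /cov_hy /mu RminusE RmultE mulrBr (mulrA _ (cPr _ _ _)) !Pr_mul_cPr //.
  by rewrite (cPrE _ _ yev) mulrA.
by apply: measurableI => //; exact: measurable_yev.
Qed.

Lemma pot_var D B : pot D B = 4 * (Pr D B * var_y D B).
Proof. by rewrite /pot giniE /var_y RminusE RmultE R1E; ring. Qed.

Lemma dropE D B h : measurable_fun setT h -> measurable B ->
  Pr D B * Delta gini D B h =
  pot D B - pot D (B `&` hev h false) - pot D (B `&` hev h true).
Proof.
move=> mh mB; rewrite /Delta /pot !RminusE !RmultE !mulrBr !(mulrA _ (cPr _ _ _)).
by rewrite !Pr_mul_cPr ?(setIC (hev _ _)) //; exact: measurable_hev.
Qed.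

(** With [s] free, the lower bound is linear in [|wcov|] and in the mass. It can thus be summed over
    all leaves with one common [s], which does the work of Cauchy-Schwarz. *)
Lemma drop_ge D B h (s : RR) : measurable_fun setT h -> measurable B ->
  16 * (2 * s * `|wcov D B h| - s ^+ 2 * Pr D B) <= Pr D B * Delta gini D B h.
Proof.
move=> mh mB; have mhev b := measurable_hev b mh.
have mBh b : measurable (B `&` hev h b) by exact: measurableI.
have my := measurable_yev; have myB : measurable (yev `&` B) by exact: measurableI.
rewrite dropE // !potE // /wcov -setIA setIC -(setIA yev) !(setIC (hev _ _)).
apply: gini_drop_ge; rewrite ?PrI_itv //; first exact: Pr_split.
by rewrite !setIA; exact: Pr_split.
Qed.

Lemma drop_ge0 D B h : measurable_fun setT h -> measurable B ->
  0 <= Pr D B * Delta gini D B h.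
Proof.
by move=> mh mB; have := drop_ge D 0 mh mB; rewrite !(mulr0, mul0r, expr0n) subrr mulr0.
Qed.

(** The constant is [4 * (1 + 3)]: 1 for the mass of [y = 1], 3 for the quotient. *)
Lemma pot_lipschitz D E B (e : RR) : measurable B ->
  `|Pr D B - Pr E B| <= e -> `|Pr D (yev `&` B) - Pr E (yev `&` B)| <= e ->
  pot D B <= pot E B + 16 * e.
Proof.
move=> mB he ye; rewrite !potE //.
have my := measurable_yev.
have := mul_div_lipschitz (PrI_itv D my mB) (PrI_itv D my mB)
  (PrI_itv E my mB) (PrI_itv E my mB) he ye ye.
by move: ye; rewrite !ler_norml => /andP[? ?] /andP[? ?]; lra.
Qed.

Lemma wcov_lipschitz D E B h (e : RR) :
  measurable_fun setT h -> measurable B ->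
  `|Pr D B - Pr E B| <= e -> `|Pr D (yev `&` B) - Pr E (yev `&` B)| <= e ->
  `|Pr D (hev h true `&` B) - Pr E (hev h true `&` B)| <= e ->
  `|Pr D ((hev h true `&` yev) `&` B) - Pr E ((hev h true `&` yev) `&` B)| <= e ->
  `|wcov D B h| <= `|wcov E B h| + 4 * e.
Proof.
move=> mh mB he ye hhe hye; have mhev := measurable_hev true mh.
have my := measurable_yev.
have lip := mul_div_lipschitz (PrI_itv D mhev mB) (PrI_itv D my mB)
  (PrI_itv E mhev mB) (PrI_itv E my mB) he hhe ye.
rewrite -lerBlDl; apply: le_trans (lerB_dist _ _) _.
have -> : 4 * e = e + 3 * e by ring.
apply: le_trans (lerD hye lip); apply: le_trans (ler_normB _ _).
by rewrite /wcov le_eqVlt; apply/orP; left; apply/eqP; congr `|_|; ring.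
Qed.
End Events.

Lemma exists_ge_average (R : realFieldType) (K : eqType) (s : seq K)
    (f : K -> R) (v : R) :
  0 < v -> v <= \sum_(k <- s) f k -> exists2 k, k \in s & v / (size s)%:R <= f k.
Proof.
move=> v0 vs; apply/hasP/negP => /negP/hasPn small.
(* Positivity of [v] excludes the empty list, whose sum is 0. *)
case: s => [|k0 s] in vs small *; first by move: vs; rewrite big_nil leNgt v0.
suff : \sum_(k <- k0 :: s) f k < \sum_(k <- k0 :: s) v / (size (k0 :: s))%:R.
  by rewrite big_const_seq count_predT iter_addr_0 -(mulr_natr (v / _)) divfK ?pnatr_eq0 // ltNge vs.
rewrite !big_cons !big_seq; apply: ltr_leD.
  by rewrite ltNge; apply: small; rewrite mem_head.
by apply: ler_sum => k ks; apply/ltW; rewrite ltNge; apply: small; rewrite inE ks orbT.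
Qed.

(** * Leaves of a tree, their events, and sums over them *)

Section Trees.
Context {d : measure_display} {X : measurableType d}.
Implicit Types (D E : @dist d X) (h : X -> bool) (t : dtree X) (p : seq bool)
  (H : set (X -> bool)).

Fixpoint tree_over H t : Prop :=
  if t is DNode h t0 t1 then [/\ H h, tree_over H t0 & tree_over H t1] else True.

Lemma size_leaves t : size (leaves t) = Defs.tsize t.
Proof. by elim: t => //= h t0 <- t1 <-; rewrite size_cat !size_map. Qed.

Lemma uniq_leaves t : uniq (leaves t).
Proof.
elim: t => //= h t0 u0 t1 u1; rewrite cat_uniq !map_inj_uniq ?u0 ?u1 //=.
- by rewrite andbT; apply/hasPn => _ /mapP[p _ ->]; apply/mapP => -[].
- by move=> ? ? [].
- by move=> ? ? [].
Qed.

Lemma path_of_leaves t x : path_of t x \in leaves t.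
Proof.
elim: t => //= h t0 IH0 t1 IH1; rewrite mem_cat.
by case: (h x); rewrite map_f ?orbT.
Qed.

Lemma eval_relabel t f x : eval_tree (relabel_aux t f) x = f (path_of t x).
Proof.
by elim: t f => //= h t0 IH0 t1 IH1 f; case: (h x).
Qed.

Lemma reach_cons h t0 t1 b p :
  reach (DNode h t0 t1) (b :: p) = hev h b `&` reach (if b then t1 else t0) p.
Proof.
rewrite /reach /hev; apply/seteqP; split=> q /=; first by case=> <- <-.
by case=> -> <-.
Qed.

Lemma measurable_reach H t p : (forall h, H h -> measurable_fun setT h) ->
  tree_over H t -> measurable (reach t p).
Proof.
move=> mH; elim: t p => [b [|c p] _|h t0 IH0 t1 IH1 [|b p] /= [Hh H0 H1]].
- by rewrite (_ : reach _ _ = setT) //; apply/seteqP.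
- by rewrite (_ : reach _ _ = set0) //; apply/seteqP; split.
- by rewrite (_ : reach _ _ = set0) //; apply/seteqP; split.
rewrite reach_cons; apply: measurableI; first by apply: measurable_hev; exact: mH.
by case: b; [exact: IH1|exact: IH0].
Qed.

Lemma reach_inj t p p' q : reach t p q -> reach t p' q -> p = p'.
Proof. by move=> <-. Qed.

(** Puts leaf events in the shape over which [weak_learning] quantifies. Index [ord0] carries the
    condition at the root, the lifted indices those of the subtree; a single leaf is the case
    [k = 0]. *)
Lemma reach_induced H t p : tree_over H t -> p \in leaves t ->
  exists (k : nat) (hs : 'I_k -> X -> bool) (bs : 'I_k -> bool),
    (forall i, H (hs i)) /\ reach t p = [set q | forall i, hs i q.1 = bs i].
Proof.
elim: t p => [b p _|h t0 IH0 t1 IH1 p /= [Hh H0 H1]].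
  rewrite inE => /eqP->; exists 0, (fun=> xpredT), xpredT; split; first by case.
  by apply/seteqP; split=> // q _ [].
have cons b t p' : (if b then t1 else t0) = t ->
    (exists (k : nat) (hs : 'I_k -> X -> bool) (bs : 'I_k -> bool),
      (forall i, H (hs i)) /\ reach t p' = [set q | forall i, hs i q.1 = bs i]) ->
    exists (k : nat) (hs : 'I_k -> X -> bool) (bs : 'I_k -> bool),
      (forall i, H (hs i)) /\
      reach (DNode h t0 t1) (b :: p') = [set q | forall i, hs i q.1 = bs i].
  move=> tb [k [hs [bs [Hhs eq_reach]]]]; exists k.+1.
  exists (fun i => oapp hs h (unlift ord0 i)), (fun i => oapp bs b (unlift ord0 i)).
  split=> [i|]; first by case: (unlift ord0 i).
  rewrite reach_cons tb eq_reach; apply/seteqP; split=> q /=.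
    by case=> hq hsq i; case: (unlift ord0 i) => [j|] //=.
  move=> hq; split; first by have := hq ord0; rewrite unlift_none.
  by move=> i; have := hq (lift ord0 i); rewrite liftK.
rewrite mem_cat => /orP[] /mapP[p' p't ->].
  by apply: (cons _ t0) => //; exact: IH0.
by apply: (cons _ t1) => //; exact: IH1.
Qed.

Lemma tree_over_grow H t p h : H h -> tree_over H t -> tree_over H (grow t p h).
Proof.
move=> Hh; elim: t p => [b [|c p]|h' t0 IH0 t1 IH1 [|[] p]] //= [? ? ?];
  by split=> //; auto.
Qed.

Lemma sum_leaves_node (f : set (X * bool) -> RR) h t0 t1 :
  \sum_(p <- leaves (DNode h t0 t1)) f (reach (DNode h t0 t1) p) =
  \sum_(p <- leaves t0) f (hev h false `&` reach t0 p) +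
  \sum_(p <- leaves t1) f (hev h true `&` reach t1 p).
Proof.
rewrite /= big_cat !big_map /=.
by congr (_ + _); apply: eq_bigr => p _; rewrite reach_cons.
Qed.

(** Stated for an arbitrary [f] so that, in the induction, the hypothesis for a subtree applies to
    [f] composed with intersection by the root condition. *)
Lemma sum_leaves_grow (f : set (X * bool) -> RR) t p h : p \in leaves t ->
  \sum_(p' <- leaves (grow t p h)) f (reach (grow t p h) p') =
  \sum_(p' <- leaves t) f (reach t p') - f (reach t p) +
  f (reach t p `&` hev h false) + f (reach t p `&` hev h true).
Proof.
elim: t p f => [b p f|h' t0 IH0 t1 IH1 p f].
  rewrite inE => /eqP-> /=; rewrite !big_cons !big_nil !reach_cons /=.
  rewrite (_ : reach (DLeaf _) [::] = setT); last by apply/seteqP.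
  rewrite (_ : reach (DLeaf _) [::] = setT); last by apply/seteqP.
  by rewrite !setTI !setIT; ring.
rewrite mem_cat => /orP[] /mapP[p' p't ->]; rewrite reach_cons -!setIA /=;
  rewrite !sum_leaves_node.
- by rewrite (IH0 p' (fun B => f (hev h' false `&` B))) //; ring.
- by rewrite (IH1 p' (fun B => f (hev h' true `&` B))) //; ring.
Qed.

Lemma tsize_grow t p h : p \in leaves t -> Defs.tsize (grow t p h) = (Defs.tsize t).+1.
Proof.
elim: t p => [b p|h' t0 IH0 t1 IH1 p]; first by rewrite inE => /eqP->.
rewrite mem_cat => /orP[] /mapP[p' p't ->] /=; first by rewrite IH0.
by rewrite IH1 // addnS.
Qed.

Lemma tsize_gt0 t : (0 < Defs.tsize t)%N.
Proof. by elim: t => //= h t0 t0_gt0 t1 _; rewrite addn_gt0 t0_gt0. Qed.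

(** The potential [Phi]. *)
Definition tree_pot E t := \sum_(p <- leaves t) pot E (reach t p).

(** * Progress of the greedy steps *)

Section Greedy.
Variables (H : set (X -> bool)).
Hypothesis mH : forall h, H h -> measurable_fun setT h.

Lemma sum_Pr_reach E t : tree_over H t ->
  \sum_(p <- leaves t) Pr E (reach t p) = 1.
Proof.
move=> Ht; rewrite -Pr_bigcup_seq ?uniq_leaves //; last 2 first.
- by move=> p; exact: measurable_reach Ht.
- by move=> p p' q; exact: reach_inj.
rewrite -(Pr_setT E); congr Pr; apply/seteqP; split=> // q _.
by exists (path_of t q.1) => //; exact: path_of_leaves.
Qed.

Lemma weak_learning_pot D (gamma : RR) t p :
  weak_learning H D gamma -> tree_over H t -> p \in leaves t ->
  exists2 h, H h & gamma * pot D (reach t p) / 4 <= `|wcov D (reach t p) h|.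
Proof.
move=> wl Ht pt; have mB := measurable_reach p mH Ht.
have [k [hs [bs [Hhs eqB]]]] := reach_induced Ht pt.
(* Weak learning says nothing about a null leaf, where the inequality is trivial, but some member of
   [H] is still needed: the assumption on the whole space ([k = 0]) supplies one. *)
have [B0|B0] := eqVneq (Pr D (reach t p)) 0.
  have noH (i : 'I_0) : H xpredT by case: i.
  have [|h Hh _] := wl 0 (fun=> xpredT) xpredT noH.
    rewrite (_ : [set _ | _] = setT) ?Pr_setT //.
    by apply/seteqP; split=> // q _ [].
  by exists h => //; rewrite pot_var B0 mul0r !mulr0 mul0r.
have {}B0 : 0 < Pr D (reach t p) by rewrite lt_def B0 Pr_ge0.
have [|h Hh wlh] := wl k hs bs Hhs; first by rewrite -eqB.
exists h => //; rewrite wcovE ?pot_var //; last exact: mH.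
rewrite -eqB in wlh; rewrite normrM (gtr0_norm B0).
have -> : gamma * (4 * (Pr D (reach t p) * var_y D (reach t p))) / 4 =
  Pr D (reach t p) * (gamma * var_y D (reach t p)) by field.
by rewrite ler_pM2l.
Qed.

(** The hypotheses are learned under [D], while the algorithm sees [E]: potential and covariance are
    both transferred leaf by leaf, and only then are the errors summed. *)
Lemma sum_wcov_ge D E (gamma eta : RR) t (hp : seq bool -> X -> bool) :
  0 < gamma <= 1 -> dTV_le D E eta -> tree_over H t ->
  (forall p, H (hp p)) ->
  (forall p, p \in leaves t ->
     gamma * pot D (reach t p) / 4 <= `|wcov D (reach t p) (hp p)|) ->
  gamma * tree_pot E t / 4 - 64 * eta <=
  \sum_(p <- leaves t) `|wcov E (reach t p) (hp p)|.
Proof.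
move=> /andP[g0 g1] tv Ht Hhp learn.
have mR p := measurable_reach p mH Ht.
have mhev p := measurable_hev true (mH (Hhp p)).
have my : measurable (yev : set (X * bool)) := measurable_yev.
pose gap (A : seq bool -> set (X * bool)) p :=
  `|Pr D (A p `&` reach t p) - Pr E (A p `&` reach t p)|.
have gap_sum A : (forall p, measurable (A p)) ->
    \sum_(p <- leaves t) gap A p <= 2 * eta.
  move=> mA; apply: (dTV_le_sumI tv mR mA) (uniq_leaves t) => p p' q.
  exact: reach_inj.
(* A common bound for the four mass differences at leaf [p]; each of them sums to at most [2 * eta],
   hence [8 * eta] in total. *)
pose e p := gap (fun=> setT) p + gap (fun=> yev) p + gap (fun p => hev (hp p) true) p
  + gap (fun p => hev (hp p) true `&` yev) p.
have e_sum : \sum_(p <- leaves t) e p <= 8 * eta.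
  rewrite !big_split /=.
  have s1 := gap_sum (fun=> setT) (fun=> measurableT).
  have s2 := gap_sum (fun=> yev) (fun=> my).
  have s3 := gap_sum (fun p => hev (hp p) true) mhev.
  have s4 := gap_sum (fun p => hev (hp p) true `&` yev)
    (fun p => measurableI _ _ (mhev p) my).
  by move: s1 s2 s3 s4; lra.
(* The potential costs [gamma * 16 * e p / 4 <= 4 * e p] and the covariance another [4 * e p];
   summing [8 * e p] gives the [64 * eta] of the statement. *)
have leaf p : p \in leaves t -> gamma * pot E (reach t p) / 4 <=
    `|wcov E (reach t p) (hp p)| + 8 * e p.
  move=> pt; have g_ge0 A : 0 <= gap A p by exact: normr_ge0.
  have e1 : gap (fun=> setT) p <= e p.
    by rewrite /e -!addrA lerDl !addr_ge0.
  rewrite /gap setTI in e1.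
  have e2 : gap (fun=> yev) p <= e p.
    by rewrite /e -!addrA addrCA lerDl !addr_ge0.
  have e3 : gap (fun p => hev (hp p) true) p <= e p.
    by rewrite /e addrAC lerDr !addr_ge0.
  have e4 : gap (fun p => hev (hp p) true `&` yev) p <= e p.
    by rewrite /e lerDr !addr_ge0.
  have pot_le : pot E (reach t p) <= pot D (reach t p) + 16 * e p.
    by apply: pot_lipschitz; rewrite // distrC.
  have := wcov_lipschitz (mH (Hhp p)) (mR p) e1 e2 e3 e4.
  have := learn p pt.
  have : gamma * pot E (reach t p) <= gamma * (pot D (reach t p) + 16 * e p).
    by rewrite ler_pM2l.
  have : gamma * (16 * e p) <= 1 * (16 * e p).
    by rewrite ler_wpM2r // mulr_ge0 // !addr_ge0.
  rewrite mul1r; move: (e p) (pot D _) (pot E _) => ep pD pE.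
  by rewrite mulrDr; lra.
have : \sum_(p <- leaves t) gamma * pot E (reach t p) / 4 <=
    \sum_(p <- leaves t) (`|wcov E (reach t p) (hp p)| + 8 * e p).
  by rewrite big_seq [leRHS]big_seq; apply: ler_sum.
rewrite big_split /= -mulr_sumr -mulr_suml -mulr_sumr -/(tree_pot E t).
by move: e_sum; lra.
Qed.

Lemma exists_good_split D E (gamma eta eps : RR) t :
  0 < gamma <= 1 -> weak_learning H D gamma -> dTV_le D E eta ->
  0 < eps -> eta <= eps * gamma / 1024 ->
  tree_over H t -> eps / 2 < tree_pot E t ->
  exists p h, [/\ p \in leaves t, H h &
    (gamma * eps) ^+ 2 / 16 / (Defs.tsize t)%:R <= score gini E t p h].
Proof.
move=> g01 wl tv eps0 eta_le Ht big_pot; have /andP[g0 g1] := g01.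
have : forall p, exists h, H h /\ (p \in leaves t ->
    gamma * pot D (reach t p) / 4 <= `|wcov D (reach t p) h|).
  move=> p; case: (boolP (p \in leaves t)) => pt.
    by have [h Hh hle] := weak_learning_pot wl Ht pt; exists h.
  (* [choice] asks for a member of [H] at every word; off the leaves, the one learned at the leaf
     reached by [point] will do. *)
  by have [h Hh _] := weak_learning_pot wl Ht (path_of_leaves t point); exists h.
move=> /choice[hp hpP].
have sum_ge := sum_wcov_ge g01 tv Ht (fun p => (hpP p).1) (fun p => (hpP p).2).
(* The sum of covariances is at least [gamma * (eps / 2) / 4 - 64 * eta], and
   [64 * eta <= gamma * eps / 16] leaves exactly [s]. *)
pose s := gamma * eps / 16.
have s0 : 0 < s by rewrite divr_gt0 ?mulr_gt0.
have S_ge : s <= \sum_(p <- leaves t) `|wcov E (reach t p) (hp p)|.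
  apply: le_trans sum_ge.
  have : gamma * (eps / 2) < gamma * tree_pot E t by rewrite ltr_pM2l.
  by move: eta_le; rewrite /s; lra.
(* Using [s] itself as slope: the masses sum to 1 and the covariances to at least [s], so the total
   is at least [16 * (2 * s * s - s ^+ 2)]. *)
have scores : 16 * s ^+ 2 <= \sum_(p <- leaves t) score gini E t p (hp p).
  apply: (@le_trans _ _ (\sum_(p <- leaves t)
    16 * (2 * s * `|wcov E (reach t p) (hp p)| - s ^+ 2 * Pr E (reach t p)))).
    rewrite -mulr_sumr big_split /= sumrN -!mulr_sumr sum_Pr_reach //.
    have : s * s <= s * \sum_(p <- leaves t) `|wcov E (reach t p) (hp p)|.
      by rewrite ler_pM2l.
    by rewrite expr2; lra.
  apply: ler_sum => p _; apply: drop_ge; first exact: mH (hpP p).1.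
  exact: measurable_reach Ht.
have [|p pt le_p] := exists_ge_average _ scores.
  by rewrite mulr_gt0 // exprn_gt0.
exists p, (hp p); split=> //; first exact: (hpP p).1.
rewrite size_leaves in le_p.
have -> : (gamma * eps) ^+ 2 / 16 = 16 * s ^+ 2 by rewrite /s; field.
exact: le_p.
Qed.

Lemma tree_pot_grow E t p h : H h -> tree_over H t -> p \in leaves t ->
  tree_pot E (grow t p h) = tree_pot E t - score gini E t p h.
Proof.
move=> Hh Ht pt; have mB := measurable_reach p mH Ht.
rewrite /tree_pot sum_leaves_grow // /score RmultE dropE //; last exact: mH.
ring.
Qed.

(** The conditional invariant is inductive because a step never raises the potential: if it is still
    large after the step, it was large before. The gain of the step then pays for
    [ln (j + 1) - ln j <= 1 / j]. *)
Lemma tdd_loop_pot D E (gamma eta eps : RR) n t :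
  0 < gamma <= 1 -> weak_learning H D gamma -> dTV_le D E eta ->
  0 < eps -> eta <= eps * gamma / 1024 ->
  tdd_loop H gini E n t -> tree_over H t /\
  (eps / 2 < tree_pot E t ->
   tree_pot E t + (gamma * eps) ^+ 2 / 16 * ln (Defs.tsize t)%:R <= 1).
Proof.
move=> g01 wl tv eps0 eta_le; elim=> [|{}t t' _ [Ht IH] _].
  split=> // _; rewrite ln1 mulr0 addr0 /tree_pot big_cons big_nil addr0.
  (* Initially [ln 1 = 0], and [4 * p * (1 - p) <= 1] because [(2 * p - 1) ^+ 2] is nonnegative. *)
  rewrite (_ : reach _ _ = setT); last by apply/seteqP.
  rewrite /pot giniE Pr_setT mul1r; have := sqr_ge0 (2 * mu E setT - 1).
  by rewrite !expr2; lra.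
case=> p [h [pt Hh -> maxi]]; split; first exact: tree_over_grow.
have mB := measurable_reach p mH Ht.
have sc0 : 0 <= score gini E t p h by apply: drop_ge0 => //; exact: mH.
rewrite tree_pot_grow // => big_pot.
have {}big_pot : eps / 2 < tree_pot E t by move: sc0 big_pot; lra.
have [p' [h' [p't Hh' le_sc]]] := exists_good_split g01 wl tv eps0 eta_le Ht big_pot.
have {}le_sc := le_trans le_sc (maxi _ _ p't Hh').
rewrite tsize_grow //; have j0 : 0 < (Defs.tsize t)%:R :> RR by rewrite ltr0n tsize_gt0.
have -> : (Defs.tsize t).+1%:R = (Defs.tsize t)%:R * (1 + (Defs.tsize t)%:R^-1) :> RR.
  by rewrite -natr1; field; rewrite gt_eqF.
have j1 : 0 < (Defs.tsize t)%:R^-1 :> RR by rewrite invr_gt0.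
rewrite lnM ?posrE ?addr_gt0 //.
have ln_le : ln (1 + (Defs.tsize t)%:R^-1) <= (Defs.tsize t)%:R^-1 :> RR.
  by apply: le_ln1Dx; apply: lt_trans j1; rewrite ltrN10.
set a := (gamma * eps) ^+ 2 / 16 in le_sc IH *.
have a0 : 0 <= a by rewrite divr_ge0 // sqr_ge0.
have := IH big_pot; have := ler_wpM2l a0 ln_le.
by rewrite mulrDr; lra.
Qed.

(** * Classification error against the potential *)

Definition wrong (f : seq bool -> bool) p : set (X * bool) :=
  if f p then ~` yev else yev.

Lemma measurable_wrong f p : measurable (wrong f p).
Proof.
have my : measurable (yev : set (X * bool)) := measurable_yev.
by rewrite /wrong; case: (f p) => //; exact: measurableC.
Qed.

Lemma error_setE t f : [set q : X * bool | eval_tree (relabel_aux t f) q.1 != q.2] =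
  [set q | exists2 p, p \in leaves t & (wrong f p `&` reach t p) q].
Proof.
apply/seteqP; split=> q /=; rewrite eval_relabel.
  move=> ne; exists (path_of t q.1); first exact: path_of_leaves.
  split=> //; rewrite /wrong /yev.
  by case: (f _) ne => /=; case: (q.2).
case=> p _ [wq]; rewrite /reach /= => ->; move: wq; rewrite /wrong /yev.
by case: (f p) => /=; case: (q.2).
Qed.

Lemma measurable_error t f : tree_over H t ->
  measurable [set q : X * bool | eval_tree (relabel_aux t f) q.1 != q.2].
Proof.
move=> Ht; rewrite error_setE; apply: measurable_bigcup_seq => p.
by apply: measurableI; [exact: measurable_wrong|exact: measurable_reach Ht].
Qed.

(** A leaf with majority label errs with conditional probability [min(m, 1 - m)], which is at most
    [2 * m * (1 - m)], half its Gini impurity. A null leaf contributes 0 whatever its label. *)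
Lemma error_le_tree_pot E t f : tree_over H t ->
  (forall p, p \in leaves t -> 0 < Pr E (reach t p) ->
    f p = (1 / 2 < mu E (reach t p))) ->
  error E (relabel_aux t f) <= tree_pot E t / 2.
Proof.
move=> Ht fP; have mR p := measurable_reach p mH Ht.
have my : measurable (yev : set (X * bool)) := measurable_yev.
rewrite /error error_setE Pr_bigcup_seq ?uniq_leaves //; last 2 first.
- by move=> p; apply: measurableI => //; exact: measurable_wrong.
- by move=> p p' q [_ h1] [_]; exact: reach_inj h1.
rewrite /tree_pot mulr_suml big_seq [leRHS]big_seq; apply: ler_sum => p pt.
have [B0|B0] := eqVneq (Pr E (reach t p)) 0.
  by have := PrI_itv E (measurable_wrong f p) (mR p); rewrite /pot B0 !mul0r => /andP[].
have {}B0 : 0 < Pr E (reach t p) by rewrite lt_def B0 Pr_ge0.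
have compl : Pr E (~` yev `&` reach t p) = Pr E (reach t p) - Pr E (yev `&` reach t p).
  apply/eqP; rewrite eq_sym subr_eq eq_sym -PrU; first last.
  - by rewrite setIACA setICl set0I.
  - exact: measurableI.
  - by apply: measurableI => //; exact: measurableC.
  - by rewrite -setIUl setvU setTI.
have yB := Pr_mul_cPr E my (mR p).
have /andP[y0 y1] := PrI_itv E my (mR p).
rewrite /wrong fP // /pot giniE /mu; rewrite /mu in fP.
set m := cPr E (reach t p) yev in yB *.
set w := Pr E (reach t p) in yB y0 y1 B0 compl *.
have m0 : 0 <= m by move: y0; rewrite -yB pmulr_rge0.
have m1 : m <= 1 by move: y1; rewrite -yB -[leRHS]mulr1 ler_pM2l.
case: ltP => hm; rewrite ?compl -yB.
  have -> : w - w * m = w * (1 - m) by ring.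
  have -> : w * (4 * m * (1 - m)) / 2 = w * (2 * m * (1 - m)) by field.
  by rewrite ler_pM2l //; have := mulr_ge0 (_ : 0 <= 1 - m) (_ : 0 <= 2 * m - 1); nra.
have -> : w * (4 * m * (1 - m)) / 2 = w * (2 * m * (1 - m)) by field.
by rewrite ler_pM2l //; nra.
Qed.

End Greedy.
End Trees.

Theorem theorem3p1 :
  exists c C : RR, 0 < c /\ 0 < C /\
  forall (d : measure_display) (X : measurableType d)
         (D : @dist d X) (gamma : RR) (H : set (X -> bool)),
    0 < gamma <= 1 ->
    (forall h, H h -> measurable_fun setT h) ->
    weak_learning H D gamma ->
    forall (eps eta : RR) (Dh : @dist d X),
      0 < eps < 1 ->
      eta <= c * eps * gamma ->
      dTV_le D Dh eta ->
      forall (t : nat) (T : dtree X),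
        expR (C / (gamma ^+ 2 * eps ^+ 2)) <= t%:R ->
        TopDownDT H gini Dh t T ->
        error D T <= eps.
Proof.
(* [1 / 1024] keeps the loss [64 * eta] below [gamma * eps / 16]; [16] is the inverse of the factor
   [1 / 16] in the gain per step. *)
exists (1024^-1)%R, 16%R; split; first by rewrite invr_gt0 ltr0n.
split=> [|d X D gamma H g01 mH wl eps eta E /andP[eps0 eps1] eta_le tv n T n_ge];
  first by rewrite ltr0n.
case=> t [f [loop /negP size_ge -> fP]]; have /andP[g0 g1] := g01.
have {}eta_le : eta <= eps * gamma / 1024 by move: eta_le; lra.
have [Ht pot_le] := tdd_loop_pot mH g01 wl tv eps0 eta_le loop.
have small_pot : tree_pot E t <= eps / 2.
  (* At this size the logarithmic term of the invariant is already at least 1, which would force the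
     potential to be nonpositive. *)
  rewrite leNgt; apply/negP => big_pot; have := pot_le big_pot.
  have ge0 : 0 < gamma * eps by rewrite mulr_gt0.
  have a0 : 0 < (gamma * eps) ^+ 2 / 16 by rewrite divr_gt0 // exprn_gt0.
  have : 16 / (gamma * eps) ^+ 2 <= ln (Defs.tsize t)%:R.
    rewrite exprMn -[leLHS]expRK ler_ln ?posrE ?expR_gt0 ?ltr0n ?tsize_gt0 //.
    by apply: le_trans n_ge _; rewrite ler_nat leqNgt.
  rewrite -(ler_pM2l a0).
  have -> : (gamma * eps) ^+ 2 / 16 * (16 / (gamma * eps) ^+ 2) = 1.
    by field; rewrite !gt_eqF.
  by move: eps0 big_pot; lra.
have err := error_le_tree_pot mH Ht fP.
(* The error under [E] is at most [eps / 4]; passing to [D] adds at most [eta <= eps / 1024], as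
   [gamma <= 1]. *)
have := tv _ (measurable_error mH f Ht).
rewrite ler_norml => /andP[_]; rewrite -/(error D _) -/(error E _).
have : eps * gamma <= eps * 1 by rewrite ler_pM2l.
by move: err small_pot eta_le eps0; lra.
Qed.
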